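(* For a graph $G$, the following conditions are equivalent: (i) $G$ has convex balls (every ball $B_r(v)$ is convex); (ii) $G$ satisfies $\mathrm{INC}$ and $\mathrm{TPC}^0$; (iii) $G$ satisfies $\mathrm{INC}$ and $\mathrm{TPC}^1$; (iv) $G$ satisfies $\mathrm{INC}$ and $\mathrm{TPC}^2$; (v) $G$ satisfies $\mathrm{INC}^+$ and $\mathrm{TPC}^+$.
   Context: All graphs are simple, undirected, connected (possibly infinite), and all cliques are finite (standing assumption). $d$ is the graph distance, $u\sim v$ denotes adjacency, $B_r(v)=\{x:d(v,x)\le r\}$, $S_r(v)=\{x:d(v,x)=r\}$, $I(u,v)=\{x:d(u,x)+d(x,v)=d(u,v)\}$. A set $C$ is convex if $I(u,v)\subseteq C$ for all $u,v\in C$. A pentagon is an induced $5$-cycle; $xwzw'y$ being a pentagon means these five vertices induce the cycle $x\sim w\sim z\sim w'\sim y\sim x$. $\mathrm{INC}^0$: for any distinct $u,v$, the neighbors of $u$ in $I(u,v)$ form a clique. $\mathrm{INC}$: $\mathrm{INC}^0$ holds and for any distinct $u,v$ and any $w,w'\in S_1(u)\cap I(u,v)$ there is $z\in I(w,v)\cap I(w',v)$ with $z\sim w,w'$. $\mathrm{INC}^+$: $\mathrm{INC}^0$ holds and for any $u,v$ with $d(u,v)=k\ge2$ there is $z\in I(u,v)$ with $d(z,v)=k-2$ adjacent to all vertices of $S_1(u)\cap I(u,v)$. For vertices $v,x,y$ with $d(v,x)=d(v,y)=k$ and $x\sim y$: $\mathrm{TC}(v,xy)$: there is $z\in B_{k-1}(v)$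 with $z\sim x,y$. $\mathrm{PC}^0(v,xy)$: there are $z,w,w'$ with $z\in B_{k-2}(v)$ such that $xwzw'y$ is a pentagon. $\mathrm{PC}^1(v,xy)$ (for $k\ge2$): for any neighbor $w\in I(x,v)$ of $x$ there are a neighbor $w'\in I(y,v)$ of $y$ and $z\in B_{k-2}(v)$ such that $xwzw'y$ is a pentagon. $\mathrm{PC}^2(v,xy)$ (for $k\ge2$): $B_2(x)\cap B_{k-2}(v)=B_2(y)\cap B_{k-2}(v)$. $\mathrm{PC}^+(v,xy)$ (for $k\ge2$): there are a neighbor $w'\in I(y,v)$ of $y$ and $z\in B_{k-2}(v)$ such that for all neighbors $w\in I(x,v)$ of $x$, $xwzw'y$ is a pentagon. $G$ satisfies $\mathrm{TPC}^i$ ($i\in\{0,1,2,+\}$) if for all $v,x,y$ with $d(v,x)=d(v,y)$ and $x\sim y$, either $\mathrm{TC}(v,xy)$ or $\mathrm{PC}^i(v,xy)$ holds.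
   Formalization: In INC the vertices w, w' are required to be distinct: with w = w' = v and d(u,v) = 1 the condition asks for z in I(v,v) = {v} adjacent to v, so literally INC fails for every edge (e.g. K_2, which has convex balls); for d(u,v) ≥ 2 the case w = w' is automatic. *)

(* Defs.v *)
From mathcomp Require Import all_boot.
From mathcomp Require Import boolp classical_sets cardinality.

Set Implicit Arguments.
Unset Strict Implicit.
Unset Printing Implicit Defensive.

Local Open Scope classical_set_scope.

(* Simple undirected connected graphs, possibly infinite. Since excluded
   middle and choice are available, taking adjacency to be boolean is no
   restriction. *)
Record cgraph := CGraph {
  vertex :> Type;
  adj : rel vertex;
  adj_sym : symmetric adj;
  adj_irrefl : irreflexive adj;
  adj_connected : forall u v : vertex,
    exists2 p : seq vertex, path adj u p & last u p = v
}.

Section Distance.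
Variable G : cgraph.

Definition walk (u v : G) (n : nat) : Prop :=
  exists p : seq G, [/\ path (@adj G) u p, last u p = v & size p = n].

Lemma walk_ex (u v : G) : exists n, `[< walk u v n >].
Proof.
by have [p pp lp] := adj_connected u v; exists (size p); apply/asboolP; exists p.
Qed.

Definition dist (u v : G) : nat := ex_minn (walk_ex u v).

End Distance.

Section Conditions.
Variable G : cgraph.
Implicit Types (u v w x y z : G) (r k : nat).

Definition gball v r : set G := [set x | dist v x <= r].

Definition gsphere v r : set G := [set x | dist v x = r].

Definition ginterval u v : set G := [set x | dist u x + dist x v = dist u v].

Definition gconvex (C : set G) : Prop :=
  forall u v, C u -> C v -> ginterval u v `<=` C.

Definition convex_balls : Prop := forall v r, gconvex (gball v r).

Definition clique (K : set G) : Prop :=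
  forall x y, K x -> K y -> x <> y -> adj x y.

Definition finite_cliques : Prop := forall K : set G, clique K -> finite_set K.

(* The induced 5-cycle x ~ w ~ z ~ w' ~ y ~ x. The five vertices are
   automatically distinct: two nonconsecutive vertices of the cycle always
   have a third one adjacent to exactly one of them. *)
Definition pentagon x w z w' y : Prop :=
  [/\ adj x w, adj w z, adj z w', adj w' y & adj y x] /\
  [/\ ~~ adj x z, ~~ adj w w', ~~ adj z y, ~~ adj w' x & ~~ adj y w].

(* S_1(u) :&: I(u,v): the neighbors of u in I(u,v). *)
Definition inbrs u v : set G := gsphere u 1 `&` ginterval u v.

Definition INC0 : Prop := forall u v, u <> v -> clique (inbrs u v).

(* w and w' have to be distinct: if d(u,v) = 1 then w = w' = v and
   I(w,v) = {v} contains no neighbor of w, while if w = w' and d(u,v) >= 2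
   then z always exists. *)
Definition INC : Prop :=
  INC0 /\
  forall u v, u <> v -> forall w w', inbrs u v w -> inbrs u v w' -> w <> w' ->
    exists z, [/\ ginterval w v z, ginterval w' v z, adj z w & adj z w'].

Definition INCplus : Prop :=
  INC0 /\
  forall u v k, dist u v = k -> 2 <= k ->
    exists z, [/\ ginterval u v z, dist z v = k - 2 &
                  forall w, inbrs u v w -> adj z w].

(* The conditions below are used for x ~ y with d(v,x) = d(v,y), and k is this
   common distance. Since x <> y, k is positive, so k - 1 is not truncated in
   TC; the hypothesis 2 <= k in the conditions PC plays this role for k - 2
   (a ball of negative radius is empty). *)
Definition TC v x y : Prop :=
  let k := dist v x in
  exists z, [/\ gball v (k - 1) z, adj z x & adj z y].

Definition PC0 v x y : Prop :=
  let k := dist v x in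
  2 <= k /\
  exists z w w', gball v (k - 2) z /\ pentagon x w z w' y.

Definition PC1 v x y : Prop :=
  let k := dist v x in
  2 <= k /\
  forall w, adj x w -> ginterval x v w ->
    exists w' z, [/\ adj y w', ginterval y v w', gball v (k - 2) z &
                     pentagon x w z w' y].

Definition PC2 v x y : Prop :=
  let k := dist v x in
  2 <= k /\
  gball x 2 `&` gball v (k - 2) = gball y 2 `&` gball v (k - 2).

Definition PCplus v x y : Prop :=
  let k := dist v x in
  2 <= k /\
  exists w' z, [/\ adj y w', ginterval y v w', gball v (k - 2) z &
    forall w, adj x w -> ginterval x v w -> pentagon x w z w' y].

Definition TPC (PC : G -> G -> G -> Prop) : Prop :=
  forall v x y, dist v x = dist v y -> adj x y -> TC v x y \/ PC v x y.

End Conditions.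

Arguments finite_cliques : clear implicits.
Arguments convex_balls : clear implicits.
Arguments INC0 : clear implicits.
Arguments INC : clear implicits.
Arguments INCplus : clear implicits.

(* Main.v *)
(** Convex balls forbid two non-adjacent neighbors of [u] in [I(u,v)], which is
INC0. Given an edge [xy] at distance [k] from [v] without a common neighbor
closer to [v], a vertex [q] at distance [k - 2] from [v] and 2 from both [x] and
[y] is the apex of a pentagon, since INC0 excludes induced squares; convexity
produces such a [q] by induction on [k]. Under INC, if one vertex at distance
[k - 2] from [v] and 2 from [x] is at distance 2 from [y], then all are, so PC0,
PC1 and PC2 amount to the same. INC propagates to INC+ along the finite clique
[S_1(u) :&: I(u,v)], again because induced squares are excluded. Conversely, let
[x p1 p2 ... y] be a shortest geodesic leaving a ball around [v] that contains
its ends. Minimality forces [p1] and [p2] to the level just above the ball, and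
both TC and PC1 at the edge [p1 p2] yield a shorter geodesic leaving the ball or
contradict INC0. *)

Require Import Defs.
From mathcomp Require Import all_boot zify.
From mathcomp Require Import boolp classical_sets cardinality.

Set Implicit Arguments.
Unset Strict Implicit.
Unset Printing Implicit Defensive.

Local Open Scope classical_set_scope.

(* Each adjacency hypothesis would cost [lia] a boolean case split. *)
Ltac metric :=
  repeat match goal with H : context [adj _ _] |- _ => clear H end; lia.

(** * Graph distance, walks and levels around a vertex *)

Section Metric.
Variable G : cgraph.
Implicit Types (a b c d p q s t u v w x y z : G) (j k n r : nat).

Lemma dist_walk u v : walk u v (dist u v).
Proof. by rewrite /dist; case: ex_minnP => n /asboolP. Qed.

Lemma dist_min u v n : walk u v n -> dist u v <= n.
Proof. by rewrite /dist => W; case: ex_minnP => m _; apply; apply/asboolP. Qed.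

Lemma dist_refl u : dist u u = 0.
Proof. by apply/eqP; rewrite -leqn0; apply: dist_min; exists [::]. Qed.

Lemma dist0_eq u v : dist u v = 0 -> u = v.
Proof. by move=> d; have := dist_walk u v; rewrite d => -[[|? ?] []]. Qed.

Lemma dist_triangle v u w : dist u w <= dist u v + dist v w.
Proof.
have [[p [pp lp <-]] [q [pq lq <-]]] := (dist_walk u v, dist_walk v w).
apply: dist_min; exists (p ++ q).
by rewrite cat_path last_cat lp pp pq lq size_cat.
Qed.

Lemma walk_sym u v n : walk u v n -> walk v u n.
Proof.
move=> [p [pp lp sp]]; exists (rev (belast u p)); split.
- by rewrite -lp rev_path (eq_path (e' := @adj G)) // => a b; rewrite adj_sym.
- by case: p {pp sp} lp => [|a p] lp //=; rewrite rev_cons last_rcons.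
- by rewrite size_rev size_belast.
Qed.

Lemma dist_sym u v : dist u v = dist v u.
Proof. by apply/eqP; rewrite eqn_leq !dist_min //; apply: walk_sym; apply: dist_walk. Qed.

Lemma dist_adj_le u v : adj u v -> dist u v <= 1.
Proof. by move=> a; apply: dist_min; exists [:: v]; rewrite /= a. Qed.

Lemma adj_neq u v : adj u v -> u <> v.
Proof. by move=> a e; move: a; rewrite e adj_irrefl. Qed.

Lemma dist_adj u v : adj u v -> dist u v = 1.
Proof.
move=> a; have := dist_adj_le a; case E: (dist u v) => [|[|]] // _.
by case: (adj_neq a (dist0_eq E)).
Qed.

Lemma distS u v n : dist u v = n.+1 -> exists2 w, adj u w & dist w v = n.
Proof.
move=> d; have := dist_walk u v; rewrite d => -[[|w p] [] //= /andP[a pp] lp [sp]].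
exists w => //; apply/eqP; rewrite eqn_leq dist_min /=; last by exists p.
by have := dist_triangle w u v; rewrite d (dist_adj a).
Qed.

Lemma distSr u v n : dist u v = n.+1 -> exists2 w, adj v w & dist u w = n.
Proof.
by rewrite dist_sym => /distS[w a d]; exists w => //; rewrite dist_sym.
Qed.

Lemma dist1_adj u v : dist u v = 1 -> adj u v.
Proof. by move=> /distS[w a /dist0_eq <-]. Qed.

Lemma dist_path2 u v w : adj u v -> adj v w -> u <> w -> ~~ adj u w -> dist u w = 2.
Proof.
move=> uv vw neq nadj; have := dist_triangle v u w.
rewrite (dist_adj uv) (dist_adj vw); case E: (dist u w) => [|[|[|]]] // _.
  by case: neq; apply: dist0_eq.
by rewrite dist1_adj in nadj.
Qed.

Lemma dist_adj_bound u v w : adj v w ->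
  dist u v <= (dist u w).+1 /\ dist u w <= (dist u v).+1.
Proof.
move=> a; have := dist_triangle v u w; have := dist_triangle w u v.
by rewrite (dist_sym w v) (dist_adj a) !addn1.
Qed.

Lemma dist_descent k v x w q : adj x w -> adj w q ->
  dist v x = k.+2 -> dist v q = k -> dist q x = 2.
Proof.
move=> xw wq dx dq; have := dist_triangle q v x; have := dist_triangle w q x.
by rewrite (dist_sym q w) (dist_sym w x) (dist_adj xw) (dist_adj wq); metric.
Qed.

Lemma inbrsP v x w k : dist v x = k.+1 ->
  (inbrs x v w <-> adj x w /\ dist v w = k).
Proof.
move=> d; rewrite /inbrs /gsphere /ginterval /= !(dist_sym _ v) d; split.
  by move=> [/= e]; rewrite e => -[]; split => //; apply: dist1_adj.
by move=> [/dist_adj -> ->].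
Qed.

End Metric.

(** * Squares, pentagons and edges without a triangle *)

Section Conditions.
Variable G : cgraph.
Implicit Types (a b c d p q s t u v w x y z : G) (j k n r : nat).

(* The working form of [~ TC]. *)
Definition no_triangle k v x y :=
  forall q, dist v q < k -> adj q x -> ~~ adj q y.

Lemma TC_or k v x y : dist v x = k.+1 -> TC v x y \/ no_triangle k.+1 v x y.
Proof.
move=> d; have [?|nTC] := EM (TC v x y); [by left|right=> q dq qx].
by apply/negP => qy; apply: nTC; exists q; rewrite d /gball /= subn1.
Qed.

Lemma no_triangle_sym k v x y : no_triangle k v x y -> no_triangle k v y x.
Proof. by move=> nT q dq; apply: contraL => /nT; apply. Qed.

Lemma INC0_adj k v x w w' : INC0 G -> dist v x = k.+1 ->
  adj x w -> adj x w' -> dist v w = k -> dist v w' = k -> w <> w' -> adj w w'.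
Proof.
move=> inc d xw xw' dw dw' neq.
apply: (inc x v) => //; try by apply/(inbrsP _ d).
by move=> e; rewrite e dist_refl in d.
Qed.

(** Non-adjacent [a] and [c] are at distance 2, and then [b] and [d] are both neighbors of [a] in
    I(a,c). *)
Lemma INC0_square a b c d : INC0 G ->
  adj a b -> adj b c -> adj c d -> adj d a -> a <> c -> b <> d ->
  ~~ adj a c -> adj b d.
Proof.
move=> inc ab bc cd da nac nbd ac.
have dac : dist c a = 2 by rewrite dist_sym (dist_path2 ab).
apply: (INC0_adj inc dac) => //; try by apply: dist_adj => //; rewrite adj_sym.
by rewrite adj_sym.
Qed.

Lemma INC_common k v x w w' : INC G -> dist v x = k.+2 ->
  adj x w -> adj x w' -> dist v w = k.+1 -> dist v w' = k.+1 -> w <> w' ->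
  exists z, [/\ adj w z, adj w' z & dist v z = k].
Proof.
move=> [_ inc] d xw xw' dw dw' neq.
have [|||z [/= iw iw' zw zw']] := inc x v _ w w' _ _ neq.
- by move=> e; rewrite e dist_refl in d.
- by apply/(inbrsP _ d).
- by apply/(inbrsP _ d).
exists z; rewrite adj_sym zw adj_sym zw'; split => //.
move: iw; rewrite /ginterval /= (dist_sym w z) (dist_adj zw) (dist_sym z) (dist_sym w) dw.
metric.
Qed.

(** The chords [w y] and [w' x] would make a triangle on [x y]. Each of the other three chords would
    close a 4-cycle with one diagonal excluded by [nT]; [INC0_square] then supplies the other
    diagonal, which is [w y] or [w' x]. *)
Lemma pentagon_intro k v x y w w' z : INC0 G ->
  dist v x = k.+1 -> dist v y = k.+1 -> adj x y -> no_triangle k.+1 v x y ->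
  adj x w -> adj y w' -> dist v w = k -> dist v w' = k ->
  adj w z -> adj w' z -> dist v z <= k -> pentagon x w z w' y.
Proof.
move=> inc dx dy xy nT xw yw' dw dw' wz w'z dz.
have nT' := no_triangle_sym nT.
have nwy : ~~ adj w y by apply: nT; rewrite ?dw // adj_sym.
have nw'x : ~~ adj w' x by apply: nT'; rewrite ?dw' // adj_sym.
have ne a b : dist v a <= k -> dist v b = k.+1 -> b <> a.
  by move=> da db e; rewrite -e db ltnn in da.
have nxz : ~~ adj x z.
  apply/negP => xz; have nzy : ~~ adj z y by apply: nT; rewrite // adj_sym.
  move: nw'x; rewrite adj_sym => /negP; apply.
  apply: (INC0_square inc (a := z) (c := y)) => //; try by rewrite adj_sym.
    by apply/nesym/ne.
  by apply: ne; rewrite ?dw'.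
have nyz : ~~ adj y z.
  apply/negP => yz; have nzx : ~~ adj z x by apply: nT'; rewrite // adj_sym.
  move: nwy; rewrite adj_sym => /negP; apply.
  apply: (INC0_square inc (a := z) (c := x)) => //; try by rewrite adj_sym.
    by apply/nesym/ne.
  by apply: ne; rewrite ?dw.
have nww' : ~~ adj w w'.
  apply/negP => ww'.
  move: nwy; apply/negP/negPn.
  apply: (INC0_square inc (a := x) (c := w')) => //; try by rewrite adj_sym.
  - by apply: ne; rewrite ?dw'.
  - by apply/nesym/ne; rewrite ?dw.
by split; split => //; rewrite adj_sym.
Qed.

Lemma ginterval_adj k v x w : dist v x = k.+1 -> adj x w ->
  (ginterval x v w <-> dist v w = k).
Proof.
move=> d xw; rewrite /ginterval /= !(dist_sym _ v) (dist_sym x) d (dist_sym w) (dist_adj xw).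
by split=> [[]|->].
Qed.

Lemma TPC_dist (PC : G -> G -> G -> Prop) k v x y : TPC PC -> adj x y ->
  dist v x = k.+1 -> dist v y = k.+1 -> no_triangle k.+1 v x y -> PC v x y.
Proof.
move=> tpc xy dx dy nT; have [|[z []]|//] := tpc v x y _ xy; first by rewrite dx.
rewrite /gball /= dx subn1 /= => dz zx zy.
by have := nT z dz zx; rewrite zy.
Qed.

Lemma TPC_intro (PC : G -> G -> G -> Prop) :
  (forall k v x y, adj x y -> dist v x = k.+1 -> dist v y = k.+1 ->
     no_triangle k.+1 v x y -> PC v x y) -> TPC PC.
Proof.
move=> H v x y e xy; case d: (dist v x) => [|k].
  have vx := dist0_eq d; rewrite d in e; have vy := dist0_eq (esym e).
  by case: (adj_neq xy); rewrite -vx.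
have [?|nT] := TC_or y d; [by left|right; apply: H nT => //].
by rewrite -e.
Qed.

Lemma no_triangle_dist2 v x y k : dist v x = k.+1 -> dist v y = k.+1 ->
  adj x y -> no_triangle k.+1 v x y -> exists j, k = j.+1.
Proof.
case: k => [|k] dx dy xy nT; last by exists k.
have := nT v; rewrite dist_refl => /(_ isT (dist1_adj dx)).
by rewrite dist1_adj.
Qed.

(** * Comparison of the pentagon conditions *)

Lemma PC0_intro k v x y q : INC0 G -> adj x y ->
  dist v x = k.+2 -> dist v y = k.+2 -> no_triangle k.+2 v x y ->
  dist v q = k -> dist q x = 2 -> dist q y = 2 -> PC0 v x y.
Proof.
move=> inc xy dx dy nT dq qx qy.
have [w xw qw] := distSr qx; have [w' yw' qw'] := distSr qy.
have dw : dist v w = k.+1.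
  by have := dist_triangle q v w; have := dist_adj_bound v xw; metric.
have dw' : dist v w' = k.+1.
  by have := dist_triangle q v w'; have := dist_adj_bound v yw'; metric.
split; first by rewrite dx.
exists q, w, w'; split; first by rewrite /gball /= dx dq subn2.
apply: (pentagon_intro inc dx dy) => //.
- by rewrite adj_sym dist1_adj.
- by rewrite adj_sym dist1_adj.
- by rewrite dq.
Qed.

(** Opposite vertices are distinct because one of them has a neighbor on the cycle that the other
    lacks. *)
Lemma pentagon_dist x w z w' y : pentagon x w z w' y ->
  [/\ dist z x = 2, dist z y = 2 & dist w w' = 2].
Proof.
move=> [[xw wz zw' w'y yx] [nxz nww' nzy nw'x nyw]].
rewrite (dist_sym z x); split.
- by apply: (dist_path2 xw wz) => // e; rewrite e adj_sym zw' in nw'x.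
- by apply: (dist_path2 zw' w'y) => // e; rewrite -e adj_sym wz in nyw.
- by apply: (dist_path2 wz zw') => // e; rewrite -e adj_sym xw in nw'x.
Qed.

Lemma PC0_elim k v x y : dist v x = k.+2 -> PC0 v x y ->
  exists q, [/\ dist v q = k, dist q x = 2 & dist q y = 2].
Proof.
move=> dx [_ [z [w [w' [bz /pentagon_dist[zx zy _]]]]]].
exists z; split => //; move: bz; rewrite /gball /= dx subn2 /=.
by have := dist_triangle z v x; metric.
Qed.

Lemma PC0_PC2 k v x y : INC G -> adj x y ->
  dist v x = k.+2 -> dist v y = k.+2 -> no_triangle k.+2 v x y ->
  PC0 v x y -> PC2 v x y.
Proof.
move=> inc.
(* The situation is symmetric in [x] and [y], so one inclusion for an arbitrary oriented edge [a b]
   is enough. *)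
suff aux a b q : adj a b -> dist v a = k.+2 -> dist v b = k.+2 ->
    no_triangle k.+2 v a b -> PC0 v a b -> dist v q <= k -> dist q a <= 2 ->
    dist q b <= 2.
  move=> xy dx dy nT pc; split; rewrite dx // subn2 /=.
  have [z [dz zx zy]] := PC0_elim dx pc.
  have pc' : PC0 v y x by apply: (PC0_intro inc.1 _ dy dx (no_triangle_sym nT) dz); rewrite 1?adj_sym.
  apply/seteqP; split => q [/=]; rewrite /gball /= ?(dist_sym x) ?(dist_sym y) => d2 dq.
    by split; last exact: dq; exact: aux xy dx dy nT pc dq d2.
  split; last exact: dq.
  by apply: aux dy dx (no_triangle_sym nT) pc' dq d2; rewrite adj_sym.
move=> ab da db nT pc dqk qa.
have {dqk} dq : dist v q = k by have := dist_triangle q v a; metric.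
have {}qa : dist q a = 2 by have := dist_triangle q v a; metric.
(* For a fixed neighbor [w] of [a], all vertices [s] of the clique of neighbors
   of [w] towards [v] are equidistant from [b]. *)
have same w s t : adj a w -> dist v w = k.+1 -> adj w s -> adj w t ->
    dist v s = k -> dist v t = k -> dist s b <= 2 -> dist t b <= 2.
  move=> aw dw ws wt ds dt sb; rewrite leqNgt; apply/negP => tb.
  have nwb : ~~ adj w b by apply: nT; rewrite ?dw // adj_sym.
  have wb : dist w b = 2.
    apply: (dist_path2 (v := a)) => //; first by rewrite adj_sym.
    by move=> e; rewrite e db in dw; metric.
  have tb3 : dist b t = 3.
    by have := dist_triangle w t b; have := dist_adj wt; rewrite !(dist_sym t) (dist_sym b); metric.
  have st : s <> t by move=> e; rewrite e in sb; metric.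
  have {}sb : dist s b = 2 by have := dist_triangle s v b; metric.
  have ts : adj t s.
    by apply: (INC0_adj inc.1 dw wt ws dt ds); apply/nesym.
  (* If [t] were at distance 3 from [b], both [w] and [s] would be neighbors of [t] towards [b].
     Their common neighbor [r] next to [b] is then adjacent to [a] by INC0 for the pair [b], [w],
     which is a triangle on [a b]. *)
  have [|||||r [wr sr br]] := INC_common (v := b) (x := t) (w := w) (w' := s) inc tb3.
  - by rewrite adj_sym.
  - by [].
  - by rewrite dist_sym.
  - by rewrite dist_sym.
  - by move=> e; rewrite e ds in dw; metric.
  have rb := dist1_adj br.
  have dr : dist v r < k.+2 by have := dist_adj_bound v sr; metric.
  have := nT r dr; rewrite (adj_sym r b) rb => /(_ _)/negP nra.
  case: nra => //.
  have bw : dist w b = 2 by [].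
  apply: (INC0_adj inc.1 (v := w) (x := b) (k := 1)) => //.
  - by rewrite adj_sym.
  - by rewrite dist_adj.
  - by rewrite dist_adj // adj_sym.
  - by move=> e; rewrite e da ltnn in dr.
have [z [dz za zb]] := PC0_elim da pc.
have down s : dist v s = k -> dist s a = 2 ->
    exists w, [/\ adj a w, dist v w = k.+1 & adj w s].
  move=> ds /distSr[w aw sw]; exists w; split => //; last by rewrite adj_sym dist1_adj.
  by have := dist_triangle s v w; have := dist_adj_bound v aw; metric.
have [w [aw dw wq]] := down q dq qa; have [w1 [aw1 dw1 w1z]] := down z dz za.
have [e|ne] := EM (w = w1).
  by apply: (same w z q) => //; rewrite ?e // zb.
(* When the descents to [q] and to [z] leave [a] through distinct [w] and [w1], their common lower
   neighbor [s] carries the bound from [z] to [q]. *)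
have [s [ws w1s ds]] := INC_common inc da aw aw1 dw dw1 ne.
apply: (same w s q) => //.
by apply: (same w1 z s) => //; rewrite zb.
Qed.

Lemma PC2_dist k v x y q : dist v x = k.+2 -> dist v y = k.+2 -> PC2 v x y ->
  dist v q = k -> dist q x = 2 -> dist q y = 2.
Proof.
move=> dx dy [_ E] dq d2.
have : (gball x 2 `&` gball v (dist v x - 2)) q.
  by split; rewrite /gball /= ?dx ?subn2 ?dq // dist_sym d2.
rewrite E => -[/=]; rewrite /gball /= dist_sym => ? _.
by have := dist_triangle q v y; metric.
Qed.

(** The vertex [w'] is chosen from [q] alone and serves every [w] below [x], which is the uniformity
    that PC+ asks for. *)
Lemma PC2_common k v x y q : INC0 G -> adj x y ->
  dist v x = k.+2 -> dist v y = k.+2 -> no_triangle k.+2 v x y -> PC2 v x y ->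
  dist v q = k -> dist q x = 2 ->
  exists w', [/\ adj y w', ginterval y v w' &
    forall w, adj x w -> ginterval x v w -> adj w q -> pentagon x w q w' y].
Proof.
move=> inc xy dx dy nT pc dq qx.
have [w' yw' qw'] := distSr (PC2_dist dx dy pc dq qx).
have dw' : dist v w' = k.+1.
  by have := dist_triangle q v w'; have := dist_adj_bound v yw'; metric.
exists w'; split=> //; first exact/(ginterval_adj dy).
move=> w xw /(ginterval_adj dx xw) dw wq.
apply: (pentagon_intro inc dx dy) => //; last by rewrite dq.
by rewrite adj_sym dist1_adj.
Qed.

Lemma PC2_PC1 k v x y : INC0 G -> adj x y ->
  dist v x = k.+2 -> dist v y = k.+2 -> no_triangle k.+2 v x y ->
  PC2 v x y -> PC1 v x y.
Proof.
move=> inc xy dx dy nT pc; split; first by rewrite dx.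
move=> w xw iw; have dw := (ginterval_adj dx xw).1 iw.
have [q wq dq] := distSr dw.
have qx : dist q x = 2.
  exact: dist_descent xw wq dx dq.
have [w' [yw' iw' pent]] := PC2_common inc xy dx dy nT pc dq qx.
by exists w', q; split => //; [rewrite /gball /= dx subn2 dq|apply: pent].
Qed.

Lemma PC1_PC0 k v x y : dist v x = k.+1 -> PC1 v x y -> PC0 v x y.
Proof.
move=> dx [k2 pc]; split => //; have [w xw dw] := distSr dx.
have [|w' [z [yw' iw' bz pent]]] := pc w xw; first exact/(ginterval_adj dx).
by exists z, w, w'.
Qed.

Lemma PCplus_PC0 k v x y : dist v x = k.+1 -> PCplus v x y -> PC0 v x y.
Proof.
move=> dx [k2 [w' [z [yw' iw' bz pent]]]]; split => //.
have [w xw dw] := distSr dx; exists z, w, w'; split => //.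
by apply: pent => //; apply/(ginterval_adj dx).
Qed.

(** INC+ provides one apex adjacent to all neighbors of [x] towards [v]. *)
Lemma PC2_PCplus k v x y : INCplus G -> adj x y ->
  dist v x = k.+2 -> dist v y = k.+2 -> no_triangle k.+2 v x y ->
  PC2 v x y -> PCplus v x y.
Proof.
move=> [inc incp] xy dx dy nT pc; split; first by rewrite dx.
have [||z [iz dz zw]] := incp x v k.+2; [by rewrite dist_sym|by []|].
rewrite subn2 /= dist_sym in dz.
have zx : dist z x = 2.
  by move: iz; rewrite /ginterval /= (dist_sym x) (dist_sym z v) (dist_sym x v); metric.
have [w' [yw' iw' pent]] := PC2_common inc xy dx dy nT pc dz zx.
exists w', z; split => //; first by rewrite /gball /= dx subn2 dz.
move=> w xw iw; apply: pent => //; rewrite adj_sym; apply: zw.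
by apply/(inbrsP w dx); split => //; apply/(ginterval_adj dx).
Qed.

Lemma INCplus_INC : INCplus G -> INC G.
Proof.
move=> [inc incp]; split => // u v neq w w' iw iw' ne.
case d: (dist u v) => [|[|k]]; first by case: neq; apply: dist0_eq.
  case: ne; move: iw iw'.
  rewrite dist_sym in d.
  by move=> /(inbrsP _ d)[_ /dist0_eq <-] /(inbrsP _ d)[_ /dist0_eq <-].
have [//|z [iz dz zw]] := incp u v _ d.
rewrite subn2 /= in dz; have d' := d; rewrite dist_sym in d'.
have [uw dw] := (inbrsP w d').1 iw; have [uw' dw'] := (inbrsP w' d').1 iw'.
exists z; split; try exact: zw;
  rewrite /ginterval /= dz (dist_sym _ v) ?dw ?dw' dist_sym dist_adj //; exact: zw.
Qed.

(** * From local conditions to convex balls *)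

Lemma INC0_TPC1_convex_balls : INC0 G -> TPC (@PC1 G) -> convex_balls G.
Proof.
move=> inc tpc v r x y.
suff H n : forall r x y, dist x y <= n -> dist v x <= r -> dist v y <= r ->
    forall z, dist x z + dist z y = dist x y -> dist v z <= r.
  by move=> bx hy z; apply: H (leqnn _) bx hy z.
(* The induction is on [dist x y], for all radii [r] at once: radius [r.+1] is
   what keeps the second vertex [p2] of the geodesic at level [r.+1]. *)
elim: n => [|n IH] {}r {}x {}y dxy dx dy z dz.
  have : dist x z = 0 by metric.
  by move=> /dist0_eq <-.
have [//|rz] := leqP (dist v z) r.
have [|p1 xp1 p1z] := distS (u := x) (v := z) (n := (dist x z).-1).
  case E: (dist x z) => [|//]; have ez := dist0_eq E.
  by rewrite -ez in rz; metric.
have dxp1 := dist_adj xp1.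
have zx : 0 < dist x z.
  by case E: (dist x z) => [|//]; have ez := dist0_eq E; rewrite -ez in rz; metric.
have p1y : (dist p1 y).+1 = dist x y.
  by have := dist_triangle z p1 y; have := dist_triangle p1 x y; metric.
(* Otherwise the geodesic from [p1] to [y] through [z] would be a shorter one leaving the ball. *)
have dp1 : r < dist v p1.
  rewrite ltnNge; apply/negP => dp1; move: rz; rewrite ltnNge => /negP; apply.
  apply: (IH r p1 y) => //; first by metric.
  by have := dist_triangle z p1 y; metric.
have [dp1' dvx] : dist v p1 = r.+1 /\ dist v x = r.
  by have := dist_adj_bound v xp1; metric.
have [|p2 p1p2 p2y] := distS (u := p1) (v := y) (n := (dist p1 y).-1).
  case E: (dist p1 y) => [|//]; have e := dist0_eq E.
  by rewrite -e in dy; metric.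
have dp1p2 := dist_adj p1p2.
have p1y0 : 0 < dist p1 y.
  by case E: (dist p1 y) => [|//]; have e := dist0_eq E; rewrite -e in dy; metric.
have dp2 : dist v p2 <= r.+1.
  by apply: (IH _ p1 y) => //; metric.
have p2x : dist x p2 = 2.
  by have := dist_triangle p2 x y; have := dist_triangle p1 x p2; metric.
have np2x : adj x p2 -> False by move/dist_adj; metric.
have p1x : adj p1 x by rewrite adj_sym.
have [dp2r|dp2r] := leqP (dist v p2) r.
  have dp2' : dist v p2 = r by have := dist_adj_bound v p1p2; metric.
  case: np2x; apply: (INC0_adj inc dp1') => //.
  by move=> e; rewrite e dist_refl in p2x.
have {dp2r}dp2 : dist v p2 = r.+1 by metric.
have [[q []]|nT] := TC_or p2 dp1'.
  rewrite /gball /= dp1' subn1 /= => dq qp1 qp2.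
  have {}dq : dist v q = r by have := dist_adj_bound v qp1; metric.
  (* The vertex [q] lies in the ball and can replace [p1], so a geodesic from [q] to [y] through
     [p2] contradicts [IH]. *)
  have xq : adj x q.
    apply: (INC0_adj inc dp1') => //; first by rewrite adj_sym.
    by move=> e; apply: np2x; rewrite e.
  have dxq := dist_adj xq; have dqp2 := dist_adj qp2.
  suff : dist v p2 <= r by metric.
  apply: (IH _ q y) => //; have := dist_triangle q x y; have := dist_triangle p2 q y; metric.
have [r2 pc] := TPC_dist tpc p1p2 dp1' dp2 nT.
have [|w' [t [p2w' iw' bt pent]]] := pc x p1x; first exact/(ginterval_adj dp1').
rewrite dp1' /gball /= in r2 bt *.
have dw' := (ginterval_adj dp2 p2w').1 iw'.
have [[_ xt tw' _ _] _] := pent.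
have dxt := dist_adj xt; have dtw' := dist_adj tw'; have dp2w' := dist_adj p2w'.
(* The pentagon offers the detour [x t w']. If [w'] were one step farther from [y], then [p2] would
   lie on a geodesic from [w'] to [y], shorter than the given one and leaving the ball. *)
have w'y : (dist w' y).+2 = dist x y.
  have ge : dist x y <= (dist w' y).+2.
    by have := dist_triangle w' x y; have := dist_triangle t x w'; metric.
  have le : dist w' y <= (dist p2 y).+1.
    by have := dist_triangle p2 w' y; rewrite (dist_sym w' p2); metric.
  have [//|] := eqVneq (dist w' y).+2 (dist x y).
  move=> ne; suff : dist v p2 <= r by metric.
  by apply: (IH _ w' y); rewrite ?dw' ?(dist_sym w' p2) //; metric.
have ty : dist y t = (dist p1 y).
  by rewrite dist_sym; have := dist_triangle w' t y; have := dist_triangle t x y; metric.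
(* Now [t] and [p1] are both neighbors of [x] towards [y], although their levels around [v] differ
   by at least 2. *)
have tp1 : adj t p1.
  apply: (INC0_adj inc (v := y) (x := x) (k := dist p1 y)) => //.
  - by rewrite dist_sym.
  - by rewrite dist_sym.
  - by move=> e; rewrite e in bt; metric.
by have := dist_adj_bound v tp1; metric.
Qed.

(** * From convex balls to local conditions *)

Lemma convex_balls_INC0 : convex_balls G -> INC0 G.
Proof.
move=> cb u v neq w w'; case d: (dist v u) => [|k].
  by case: neq; rewrite (dist0_eq d).
move=> /(inbrsP _ d)[uw dw] /(inbrsP _ d)[uw' dw'] ne.
apply: contrapT => /negP nww'.
have wu : adj w u by rewrite adj_sym.
suff : gball v k u by rewrite /gball /= d ltnn.
apply: (cb v k w w'); rewrite /gball /ginterval /= ?dw ?dw' //.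
by rewrite (dist_path2 wu uw') // !dist_adj.
Qed.

Lemma convex_balls_PC0 k v x y : convex_balls G -> adj x y ->
  dist v x = k.+2 -> dist v y = k.+2 -> no_triangle k.+2 v x y -> PC0 v x y.
Proof.
move=> cb; have inc := convex_balls_INC0 cb.
have ball c r a b z : dist c a <= r -> dist c b <= r ->
    dist a z + dist z b = dist a b -> dist c z <= r.
  by move=> da db dz; apply: (cb c r a b da db).
elim/ltn_ind: k v x y => k IH v x y xy dx dy nT.
have nT' := no_triangle_sym nT.
have dxy := dist_adj xy.
have [w xw dw] := distSr dx; have [w' yw' dw'] := distSr dy.
have wx : adj w x by rewrite adj_sym.
have w'y : adj w' y by rewrite adj_sym.
have [dwx dw'y] := (dist_adj wx, dist_adj w'y).
have ne a b i : dist v a < i -> dist v b = i -> a <> b by move=> + + e; rewrite e; metric.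
have nwy : ~~ adj w y by apply: nT; rewrite ?dw.
have nw'x : ~~ adj w' x by apply: nT'; rewrite ?dw'.
have wy : dist w y = 2 by apply: (dist_path2 wx xy) => //; apply: ne dy; rewrite dw.
have w'x : dist w' x = 2.
  by apply: (dist_path2 w'y) => //; [rewrite adj_sym|apply: ne dx; rewrite dw'].
(* At distance 3, [x] would lie on a geodesic between [w] and [w'], hence in the ball of radius
   [k.+1]. At distance 1, [x w w' y] would be an induced square. *)
have ww' : dist w w' = 2.
  have [l3 l2] : dist w w' <= 3 /\ dist w w' <> 3.
    split; first by have := dist_triangle y w w'; rewrite (dist_sym y w'); metric.
    move=> e; suff : dist v x <= k.+1 by metric.
    by apply: (ball _ _ w w'); rewrite ?dw ?dw' // (dist_sym x); metric.
  case E: (dist w w') => [|[|[|]]] //; try metric.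
    by move: nwy; rewrite (dist0_eq E) w'y.
  move/negP: nwy; case; apply: (INC0_square inc (a := x) (c := w')) => //.
  - by rewrite dist1_adj.
  - by rewrite adj_sym.
  - by apply/nesym; apply: ne dx; rewrite dw'.
  - by apply: ne dy; rewrite dw.
  - by rewrite adj_sym.
(* If there is no apex [q], then for [dist v x >= 4] a contradiction comes from
   the induction hypothesis at a vertex [p] at distance 3 from [x] and [y]; for
   [dist v x = 3] there is no smaller instance and convexity is used directly. *)
have [[q [dq qx qy]]|nq] := EM (exists q, [/\ dist v q = k, dist q x = 2 & dist q y = 2]).
  exact: (PC0_intro inc xy dx dy nT dq).
case: k => [|k] in IH dx dy nT nT' dw dw' nq *.
  case: nq; exists v; rewrite dist_refl dx dy; split => //.
have far a : adj w a -> dist v a = k.+1 -> dist a x = 2 /\ dist a y = 3.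
  move=> wa da; have ax : dist a x = 2.
    exact: dist_descent xw wa dx da.
  split => //; have := dist_triangle a v y; have := dist_triangle x a y.
  have [|] := eqVneq (dist a y) 2; last by metric.
  by move=> ay; case: nq; exists a.
have near a : dist a x <= 2 -> dist a w' <= 2 -> dist a y <= 2.
  by move=> ax aw'; apply: (ball _ _ x w'); rewrite // dxy (dist_sym x w') (dist_sym y) dw'y.
case: k => [|k] in IH dx dy nT nT' dw dw' nq far *.
  have [a wa da] := distSr dw; have [ax ay] := far a wa da.
  have aw' : dist a w' = 3.
    by have := near a; have := dist_triangle v a w'; rewrite (dist_sym a v); metric.
  have aw : adj a w by rewrite adj_sym.
  have av : adj a v by rewrite adj_sym dist1_adj.
  (* Both [w] and [v] are neighbors of [a] towards [w'], yet [v] and [w] are at distance 2. *)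
  have : adj w v.
    apply: (INC0_adj inc (v := w') (x := a) (k := 2)) => //; rewrite 1?dist_sym //.
    by move=> e; rewrite e dist_refl in dw.
  by move/dist_adj; rewrite dist_sym dw.
have [z wz zw'] := distS ww'.
have w'z : adj w' z by rewrite adj_sym dist1_adj.
have [dwz dzw'] := (dist_adj wz, zw').
have dz : dist v z <= k.+3.
  by apply: (ball _ _ w w'); rewrite ?dw ?dw' //; metric.
have [zx zy _] := pentagon_dist
  (pentagon_intro inc dx dy xy nT xw yw' dw dw' wz w'z dz).
have {}dz : dist v z = k.+3.
  have [|] := eqVneq (dist v z) k.+2; first by move=> ?; case: nq; exists z.
  by have := dist_adj_bound v wz; metric.
have [[s []]|nTz] := TC_or z dw.
  rewrite /gball /= dw subn1 /= => ds sw sz.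
  have {}ds : dist v s = k.+2 by have := dist_adj_bound v sw; metric.
  have ws : adj w s by rewrite adj_sym.
  have [sx sy] := far s ws ds.
  suff : dist s y <= 2 by metric.
  apply: near; rewrite ?sx //.
  by have := dist_triangle z s w'; rewrite (dist_adj sz); metric.
have [_ [p [a [b [bp pent]]]]] := IH k.+1 (ltnSn _) v w z wz dw dz nTz.
rewrite /gball /= dw !subSS subn0 in bp.
have [pw pz ab] := pentagon_dist pent.
have [[wa ap pb bz _] _] := pent.
have dp : dist v p = k.+1 by have := dist_triangle p v w; metric.
have da : dist v a = k.+2.
  by have := dist_adj_bound v ap; have := dist_adj_bound v wa; metric.
have [ax ay] := far a wa da.
have yb : dist y b <= 3.
  by have := dist_triangle z y b; rewrite (dist_sym y z) (dist_sym z b) (dist_adj bz); metric.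
(* The ball of radius 3 around [y] contains [a] and [b], and [p] is midway between them. *)
have py3 : dist y p <= 3.
  apply: (ball _ _ a b) => //; first by rewrite dist_sym ay.
  by rewrite ab (dist_adj ap) (dist_adj pb).
rewrite dist_sym in py3.
have px : dist p x = 3.
  by have := dist_triangle w p x; have := dist_triangle p v x; metric.
have py : dist p y = 3 by have := dist_triangle p v y; metric.
(* Seen from [p], the edge [x y] is at distance 3, and the apex found there is adjacent to [p]. Its
   level around [v] makes it the apex assumed missing. *)
have [|q [pq qx qy]] := PC0_elim px (IH 1 isT p x y xy px py _).
  by move=> q pq; apply: nT; have := dist_triangle p v q; metric.
case: nq; exists q; split => //.
have := dist_triangle p v q; have := dist_triangle q v x; metric.
Qed.

Lemma convex_balls_INC : convex_balls G -> INC G.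
Proof.
move=> cb; have inc := convex_balls_INC0 cb; split => // u v neq w w'.
case d: (dist v u) => [|[|k]]; first by case: neq; rewrite (dist0_eq d).
  by move=> /(inbrsP _ d)[_ /dist0_eq <-] /(inbrsP _ d)[_ /dist0_eq <-].
move=> /(inbrsP _ d)[uw dw] /(inbrsP _ d)[uw' dw'] ne.
have ww' := INC0_adj inc d uw uw' dw dw' ne.
have [[z []]|nT] := TC_or w' dw.
  rewrite /gball /= dw subn1 /= => bz zw zw'; exists z.
  have dz : dist v z = k by have := dist_adj_bound v zw; metric.
  split => //; rewrite /ginterval /= (dist_sym z) dz (dist_sym _ v) (dist_sym _ z).
    by rewrite dw (dist_adj zw).
  by rewrite dw' (dist_adj zw').
(* A pentagon [w a z b w'] would put [a] and [b], but not [z], in the ball of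
   radius 2 around [u]. *)
have [j kj] := no_triangle_dist2 dw dw' ww' nT; subst k.
have [_ [z [a [b [bz pent]]]]] := convex_balls_PC0 cb ww' dw dw' nT.
have [[wa az zb bw' _] _] := pent.
have [_ _ ab] := pentagon_dist pent.
rewrite /gball /= dw subn2 /= in bz.
suff : dist u z <= 2.
  by have := dist_triangle z v u; rewrite (dist_sym u); metric.
have two c c' : adj u c -> adj c c' -> dist u c' <= 2.
  move=> uc cc'; have := dist_triangle c u c'.
  by rewrite (dist_adj uc) (dist_adj cc').
apply: (cb u 2 a b); first exact: two uw wa.
  by apply: (two w') => //; rewrite adj_sym.
by rewrite /ginterval /= ab (dist_adj az) (dist_adj zb).
Qed.

(** * From INC to INC+ *)

Lemma INC_INCplus : finite_cliques G -> INC G -> INCplus G.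
Proof.
move=> fin INC_G; have [inc _] := INC_G; split => // u v k d k2.
case: k => [|[|k]] // in d k2 *.
have d' := d; rewrite dist_sym in d'.
have uv : u <> v by move=> e; rewrite e dist_refl in d.
have /(@finite_seqP {classic G}) [l El] := fin _ (inc u v uv).
have lP w : ((w : {classic G}) \in l) <-> adj u w /\ dist v w = k.+1.
  rewrite -(inbrsP w d').
  by rewrite [inbrs u v]El.
suff [z dz zl] : exists2 z, dist v z = k &
    forall w, (w : {classic G}) \in l -> adj z w.
  have [w uw dw] := distSr d'.
  have zw : adj z w by apply/zl/lP.
  have zu : dist z u = 2 by apply: dist_descent uw _ d' dz; rewrite adj_sym.
  exists z; split; last by move=> w' /(inbrsP _ d') /lP/zl.
    by rewrite /ginterval /= (dist_sym u) zu (dist_sym z) dz d.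
  by rewrite dist_sym dz subn2.
(* Only this direction of [lP] passes to sublists, and it suffices for the induction on [l]. *)
have lP' w : (w : {classic G}) \in l -> adj u w /\ dist v w = k.+1 by move/lP.
elim: l lP' {El lP} => [|w1 [|w l] IH] lP.
- have [w _ dw] := distSr d'; have [z _ dz] := distSr dw.
  by exists z.
- have [|uw1 dw1] := lP w1; first by rewrite inE.
  have [z wz dz] := distSr dw1; exists z => // w'.
  by rewrite inE => /eqP ->; rewrite adj_sym.
have [|z dz zl] := IH; first by move=> w' w'l; apply: lP; rewrite inE w'l orbT.
have [|uw1 dw1] := lP w1; first by rewrite inE eqxx.
have [|uw dw] := lP w; first by rewrite !inE eqxx orbT.
have zw : adj z w by apply: zl; rewrite inE eqxx.
have [zw1|nzw1] := boolP (adj z w1).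
  by exists z => // w'; rewrite inE => /predU1P[->|/zl].
have ww1 : w <> w1 by move=> e; rewrite -e zw in nzw1.
(* If [z] misses [w1], then a common neighbor [s] of [w] and [w1] one level
   below is adjacent to [z], and an induced square [w1 w2 z s] is excluded. *)
have [s [ws w1s ds]] := INC_common INC_G d' uw uw1 dw dw1 ww1.
have zs : z <> s by move=> e; rewrite e adj_sym w1s in nzw1.
have zs' : adj z s.
  by apply: (INC0_adj inc dw) => //; rewrite adj_sym.
exists s => // w2; rewrite inE => /predU1P[->|w2l]; first by rewrite adj_sym.
have [|uw2 dw2] := lP w2; first by rewrite inE w2l orbT.
have zw2 := zl w2 w2l.
have w12 : w1 <> w2 by move=> e; rewrite e zw2 in nzw1.
apply: (INC0_square inc (a := z) (c := w1)) => //.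
- by rewrite adj_sym.
- by apply: (INC0_adj inc d').
- by rewrite adj_sym.
- by move=> e; rewrite e dw1 in dz; metric.
- by move=> e; rewrite e dw2 in ds; metric.
Qed.

End Conditions.

(** * The cycle of implications *)

Theorem theorem3p2 (G : cgraph) (hfin : finite_cliques G) :
  [<-> convex_balls G;
       INC G /\ TPC (@PC0 G);
       INC G /\ TPC (@PC1 G);
       INC G /\ TPC (@PC2 G);
       INCplus G /\ TPC (@PCplus G)].
Proof.
have lift (PC PC' : G -> G -> G -> Prop) :
    (forall k v x y, adj x y -> dist v x = k.+2 -> dist v y = k.+2 ->
      no_triangle k.+2 v x y -> PC v x y -> PC' v x y) ->
    TPC PC -> TPC PC'.
  move=> H tpc; apply: TPC_intro => k v x y xy dx dy nT.
  have [j kj] := no_triangle_dist2 dx dy xy nT; rewrite kj in dx dy nT.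
  exact: H nT (TPC_dist tpc xy dx dy nT).
have P02 : INC G -> TPC (@PC0 G) -> TPC (@PC2 G).
  by move=> inc; apply: lift => k v x y; apply: PC0_PC2.
have P21 : INC0 G -> TPC (@PC2 G) -> TPC (@PC1 G).
  by move=> inc; apply: lift => k v x y; apply: PC2_PC1.
have P10 : TPC (@PC1 G) -> TPC (@PC0 G).
  by apply: lift => k v x y _ dx _ _; apply: PC1_PC0 dx.
tfae.
- move=> cb; split; first exact: convex_balls_INC.
  apply: TPC_intro => k v x y xy dx dy nT.
  have [j kj] := no_triangle_dist2 dx dy xy nT; rewrite kj in dx dy nT.
  exact: convex_balls_PC0 cb xy dx dy nT.
- by move=> [inc tpc]; split => //; apply: P21 inc.1 (P02 inc tpc).
- by move=> [inc tpc]; split => //; apply: P02 inc (P10 tpc).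
- move=> [inc tpc]; have incp := INC_INCplus hfin inc; split => //.
  by apply: lift tpc => k v x y; apply: PC2_PCplus.
- move=> [incp tpc]; have inc := INCplus_INC incp.
  apply: (INC0_TPC1_convex_balls inc.1); apply: (P21 inc.1); apply: (P02 inc).
  by apply: lift tpc => k v x y _ dx _ _; apply: PCplus_PC0 dx.
Qed.
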